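(* Let $X=\mathcal{V}(\varphi)_+$ for some piecewise-linear function $\varphi:\mathbb{R}^2\to\mathbb{R}$. Let $\mathcal{V}_1+\cdots+\mathcal{V}_n$ be a minimal balancing of $X$ with respect to factorization complexity. Then $$\mathrm{fComp}(\mathcal{A}_X)\le 3\,\mathrm{fComp}(\mathcal{V}_1+\cdots+\mathcal{V}_n),$$ where $\mathcal{A}_X$ is the associated arrangement of $X$, given as the sum of all its hyperplanes.
   Context: A tropical polynomial on $\mathbb{R}^d$ is a function $g(x)=\max_{1\le i\le n}(\langle b_i,x\rangle+a_i)$, $a_i\in\mathbb{R}$, $b_i\in\mathbb{R}^d$; piecewise-linear functions (continuous, finitely many affine pieces) are the differences of two tropical polynomials. $\mathcal{V}(\varphi)=\{x:\varphi\text{ is not affine in any neighbourhood of }x\}$ is a pure $(d-1)$-dimensional polyhedral complex, weighted by $w_\varphi(\sigma)=\pm\|u_1-u_2\|$ on a $(d-1)$-face $\sigma$ separating regions with gradients $u_1,u_2$, with sign $+$ if $\varphi$ is locally convex along $\sigma$ and $-$ if locally concave. $\mathcal{V}(\varphi)_+$ is the subcomplex of positive-weight faces, i.e. the closure of the set of points near which $\varphi$ is convex and not affine, with weight $|w_\varphi|$. Polyhedral structures are considered up to refinement. A tropical hypersurface is $\mathcal{V}(g)$ (with its weights) for a tropical polynomial $g$. The sum of weighted complexes is their union with weights added where $(d-1)$-dimensional parts overlap; $\mathcal{V}(g+h)=\mathcal{V}(g)+\mathcal{V}(h)$. A tropical hypersurface $Z$ with weight $w_Z$ is a balancing of $X=\mathcal{V}(\varphi)_+$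 if $X$ is a subcomplex of $Z$ and $w_Z(\sigma)\ge w_\varphi(\sigma)$ for every $(d-1)$-face $\sigma$ of $X$. For a tropical hypersurface $Z$, $\mathrm{mComp}(Z)$ is the number of connected components of $\mathbb{R}^d\setminus Z$. For a tropical hypersurface given as a sum of tropical hypersurfaces, $\mathrm{fComp}(\mathcal{V}_1+\cdots+\mathcal{V}_n)=\sum_{i=1}^n\mathrm{mComp}(\mathcal{V}_i)-(n-1)$ (it depends on the decomposition). A minimal balancing of $X$ with respect to factorization complexity is a balancing $\mathcal{V}_1+\cdots+\mathcal{V}_n$ of $X$, given as a sum of tropical hypersurfaces $\mathcal{V}_i$, whose $\mathrm{fComp}$ is smallest among all balancings of $X$ given as sums of tropical hypersurfaces. The associated arrangement $\mathcal{A}_X$ is the collection of all affine hyperplanes (lines when $d=2$) spanned by the $(d-1)$-faces of $X$, with weights inherited from the faces; it is a balancing of $X$. If it has $N$ distinct hyperplanes, then, given as the sum of these hyperplanes, $\mathrm{fComp}(\mathcal{A}_X)=2N-(N-1)=N+1$. *)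

(* Defs.v *)
(* MathComp / MathComp-Analysis.  The reals are an arbitrary [R : realType] and
   R^d is ['rV[R]_d] with its canonical topology.  That type's library norm is
   the sup norm, so the Euclidean norm is defined explicitly. *)
From HB Require Import structures.
From mathcomp Require Import all_boot all_order all_algebra.
From mathcomp Require Import finmap.
From mathcomp Require Import all_classical all_reals all_analysis.
Set Implicit Arguments.
Unset Strict Implicit.
Unset Printing Implicit Defensive.
Import Order.TTheory GRing.Theory Num.Theory numFieldNormedType.Exports.
Local Open Scope classical_set_scope.
Local Open Scope ring_scope.

Definition dot (R : realType) (d : nat) (u v : 'rV[R]_d) : R :=
  \sum_(i < d) u 0 i * v 0 i.

Definition enorm (R : realType) (d : nat) (u : 'rV[R]_d) : R :=
  Num.sqrt (dot u u).

(* The maximum is over n+1 >= 1 affine functions; the default value of the big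
   operator is one of them, hence harmless. *)
Definition tropical_polynomial (R : realType) (d : nat)
    (g : 'rV[R]_d -> R) : Prop :=
  exists (n : nat) (b : 'I_n.+1 -> 'rV[R]_d) (a : 'I_n.+1 -> R),
    forall x, g x =
      \big[Num.max / (dot (b ord0) x + a ord0)]_(i < n.+1) (dot (b i) x + a i).

Definition polyhedron (R : realType) (d : nat) (P : set 'rV[R]_d) : Prop :=
  exists (m : nat) (c : 'I_m -> 'rV[R]_d) (e : 'I_m -> R),
    P = [set x | forall i, dot (c i) x <= e i].

Definition piecewise_linear (R : realType) (d : nat)
    (phi : 'rV[R]_d -> R) : Prop :=
  continuous phi /\
  exists (m : nat) (P : 'I_m -> set 'rV[R]_d)
         (b : 'I_m -> 'rV[R]_d) (a : 'I_m -> R),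
    [/\ forall i, polyhedron (P i),
        \bigcup_i P i = setT
      & forall i x, P i x -> phi x = dot (b i) x + a i].

Definition hyperplane (R : realType) (d : nat) (H : set 'rV[R]_d) : Prop :=
  exists (b : 'rV[R]_d) (c : R), b != 0 /\ H = [set x | dot b x = c].

Definition affspan (R : realType) (d : nat) (S : set 'rV[R]_d) :
    set 'rV[R]_d :=
  [set y | exists (k : nat) (t : 'I_k -> R) (x : 'I_k -> 'rV[R]_d),
     [/\ forall i, S (x i), \sum_(i < k) t i = 1
       & y = \sum_(i < k) t i *: x i]].

Definition relint (R : realType) (d : nat) (S : set 'rV[R]_d) :
    set 'rV[R]_d :=
  [set x | S x /\ \forall y \near x, affspan S y -> S y].

(* dimension d-1 is read off from the affine hull *)
Definition facet (R : realType) (d : nat) (sigma : set 'rV[R]_d) : Prop :=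
  polyhedron sigma /\ hyperplane (affspan sigma).

Definition affine_near (R : realType) (d : nat)
    (phi : 'rV[R]_d -> R) (x : 'rV[R]_d) : Prop :=
  exists (b : 'rV[R]_d) (a : R), \forall y \near x, phi y = dot b y + a.

Definition convex_near (R : realType) (d : nat)
    (phi : 'rV[R]_d -> R) (x : 'rV[R]_d) : Prop :=
  exists2 e : R, 0 < e & convex_function (ball x e) phi.

Definition concave_near (R : realType) (d : nat)
    (phi : 'rV[R]_d -> R) (x : 'rV[R]_d) : Prop :=
  convex_near (fun y => - phi y) x.

(* Weighted polyhedral complexes of pure dimension d-1, up to refinement.
   [cells Z (sigma, w)] means that the (d-1)-dimensional polyhedron sigma is a
   cell of a sufficiently fine polyhedral structure adapted to Z, and that Z has
   weight w on it.  Cells whose relative interior misses the support are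
   included, with weight 0; this lets sums be taken cell by cell. *)
Record wcomplex (R : realType) (d : nat) := WComplex {
  supp : set 'rV[R]_d;
  cells : set (set 'rV[R]_d * R)
}.

Definition face (R : realType) (d : nat) (Z : wcomplex R d)
    (sigma : set 'rV[R]_d) (w : R) : Prop :=
  cells Z (sigma, w) /\ w != 0.

(* Along the relative interior of sigma, phi has gradient u1 on one side of the
   hyperplane spanned by sigma and u2 on the other.  The case u1 = u2 says that
   phi is affine near the relative interior of sigma. *)
Definition separates (R : realType) (d : nat) (phi : 'rV[R]_d -> R)
    (sigma : set 'rV[R]_d) (u1 u2 : 'rV[R]_d) : Prop :=
  exists (b : 'rV[R]_d) (c : R),
    [/\ b != 0, affspan sigma = [set y | dot b y = c]
      & forall x, relint sigma x -> \forall y \near x,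
          (c <= dot b y -> phi y = phi x + dot u1 (y - x)) /\
          (dot b y <= c -> phi y = phi x + dot u2 (y - x))].

Definition Vcomplex (R : realType) (d : nat) (phi : 'rV[R]_d -> R) :
    wcomplex R d :=
  WComplex
    [set x | ~ affine_near phi x]
    [set p | facet p.1 /\ exists u1 u2 : 'rV[R]_d,
       separates phi p.1 u1 u2 /\
       (((forall x, relint p.1 x -> convex_near phi x) /\
           p.2 = enorm (u1 - u2)) \/
        ((forall x, relint p.1 x -> concave_near phi x) /\
           p.2 = - enorm (u1 - u2)))].

(* Cells of V(phi) of negative weight are not part of V(phi)_+, hence have
   weight 0 in it. *)
Definition Vplus (R : realType) (d : nat) (phi : 'rV[R]_d -> R) :
    wcomplex R d :=
  WComplex
    (closure [set x | convex_near phi x /\ ~ affine_near phi x])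
    [set p | exists2 w : R,
       cells (Vcomplex phi) (p.1, w) & p.2 = Num.max w 0].

Definition tropical_hypersurface (R : realType) (d : nat)
    (Z : wcomplex R d) : Prop :=
  exists2 g : 'rV[R]_d -> R, tropical_polynomial g & Z = Vcomplex g.

(* V_1 + ... + V_n: a cell of the sum is a cell of a common refinement *)
Definition wsum (R : realType) (d n : nat) (V : 'I_n -> wcomplex R d) :
    wcomplex R d :=
  WComplex
    (\bigcup_i supp (V i))
    [set p | exists2 w : 'I_n -> R,
       forall i, cells (V i) (p.1, w i) & p.2 = \sum_(i < n) w i].

Definition balancing (R : realType) (d : nat) (Z X : wcomplex R d) : Prop :=
  [/\ tropical_hypersurface Z,
      supp X `<=` supp Z
    & forall sigma wX wZ,
        face X sigma wX -> cells Z (sigma, wZ) -> wX <= wZ].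

(* [fset_set] is the empty set on infinite sets; the complement of a tropical
   hypersurface always has finitely many components. *)
Definition mComp (R : realType) (d : nat) (Z : wcomplex R d) : nat :=
  #|` fset_set [set C : set 'rV[R]_d |
        exists2 x, ~ supp Z x & C = connected_component (~` supp Z) x] |.

(* Integer-valued, so that the empty sum (the arrangement of an empty X) has
   value 0 - (0 - 1) = 1 without truncation. *)
Definition fComp (R : realType) (d n : nat) (V : 'I_n -> wcomplex R d) : int :=
  \sum_(i < n) (mComp (V i))%:Z - (n%:Z - 1).

Definition sum_balancing (R : realType) (d n : nat)
    (V : 'I_n -> wcomplex R d) (X : wcomplex R d) : Prop :=
  [/\ (0 < n)%N, forall i, tropical_hypersurface (V i)
    & balancing (wsum V) X].

Definition minimal_fbalancing (R : realType) (d n : nat)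
    (V : 'I_n -> wcomplex R d) (X : wcomplex R d) : Prop :=
  sum_balancing V X /\
  forall (m : nat) (V' : 'I_m -> wcomplex R d),
    sum_balancing V' X -> fComp V <= fComp V'.

Definition whyperplane (R : realType) (d : nat) (H : set 'rV[R]_d) (w : R) :
    wcomplex R d :=
  WComplex H
    [set p | facet p.1 /\
       ((p.1 `<=` H /\ p.2 = w) \/ (relint p.1 `&` H = set0 /\ p.2 = 0))].

(* Each hyperplane spanned by a face of X occurs exactly once.  When it is
   spanned by several faces it gets the largest of their weights: unlike their
   sum, this does not change under refinement, and it makes the arrangement a
   balancing of X. *)
Definition arrangement (R : realType) (d : nat) (X : wcomplex R d) :
    set (wcomplex R d) :=
  [set A | exists (sigma : set 'rV[R]_d) (w : R),
     [/\ face X sigma w,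
         forall tau v, face X tau v -> affspan tau = affspan sigma -> v <= w
       & A = whyperplane (affspan sigma) w]].

(* The family A lists the hyperplanes of the associated arrangement of X,
   without repetition. *)
Definition lists_arrangement (R : realType) (d N : nat)
    (A : 'I_N -> wcomplex R d) (X : wcomplex R d) : Prop :=
  injective A /\ range A = arrangement X.

(* Main.v *)
Require Import Defs.
From HB Require Import structures.
From mathcomp Require Import all_boot all_order all_algebra.
From mathcomp Require Import finmap.
From mathcomp Require Import all_classical all_reals all_analysis.
From mathcomp Require Import ring lra zify.
Set Implicit Arguments.
Unset Strict Implicit.
Unset Printing Implicit Defensive.
Import Order.TTheory GRing.Theory Num.Theory numFieldNormedType.Exports.
Local Open Scope classical_set_scope.
Local Open Scope ring_scope.

(* Every face of X lies in the union of the V_i, so the line it spans contains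
   infinitely many points of some V_i and is spanned by an edge of it.  A
   tropical curve with k complementary regions has at most 3(k - 1) edges; this
   is shown by sweeping the plane with a generic line and charging each edge to
   a region adjacent to the place where it starts, each region receiving at
   most three charges.  Summing over i gives N <= 3 sum_i (k_i - 1), hence
   N + 1 <= 3 fComp(V_1 + ... + V_n). *)

(** The edge bound is classically read off Euler's formula for the dual subdivision. Here an edge is
    an ordered pair of regions tied at two different times, so only inequalities between affine
    functions enter and no planar graph is built; several edges on one line merely overcount lines.
    The constant 3 is the number of positions (left, right, between) that the slope of the function
    causing a start can take relative to the two regions of the edge. Each position charges
    injectively and misses a region, which gives k - 1 instead of k. *)

Lemma fin_bounded (R : realDomainType) (I : finType) (b : I -> R) :
  exists M, forall i, `|b i| <= M.
Proof.
exists (\sum_i `|b i|) => i; rewrite (bigD1 i)//= lerDl.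
by apply: sumr_ge0.
Qed.

(** * Counting the edges of a tropical curve by a sweep *)

Section Sweep.
(* Sweep coordinates (x, t), t being the time.  At a fixed time the maximum of
   the affine functions is a convex function of x, and since p is injective the
   regions are met from left to right in the order of increasing p. *)
Variables (R : realType) (I : finType) (p q a : I -> R).
Definition ht i x t := p i * x + q i * t + a i.
Hypothesis ess : forall i, exists x t, forall j, j != i -> ht j x t < ht i x t.
Hypothesis p_inj : injective p.

Definition maximal i x t := forall k, ht k x t <= ht i x t.
Definition live i t := exists x, maximal i x t.
Definition tie i j t := exists x, maximal i x t /\ maximal j x t.
(** Two distinct times exclude pairs that meet only at a vertex; as [p] is injective, no edge lies
    at constant time. The order of slopes selects one orientation. *)
Definition sweep_edge i j := p i < p j /\ exists s t, [/\ s < t, tie i j s & tie i j t].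

Lemma maximal_eq i j x t : maximal i x t -> maximal j x t -> ht i x t = ht j x t.
Proof. by move=> hi hj; apply/eqP; rewrite eq_le hj hi. Qed.

(** Both functions are maximal on a set cut out by linear inequalities in (x, t), hence convex. *)
Lemma tie_between i j s r t : s <= r -> r <= t -> tie i j s -> tie i j t ->
  tie i j r.
Proof.
move=> sr rt [x [ix jx]] [y [iy jy]].
have [st|st] := eqVneq s t.
  by exists x; have -> : r = s by apply/eqP; rewrite eq_le sr st rt.
have ts0 : 0 < t - s by rewrite subr_gt0 lt_neqAle st (le_trans sr).
pose u := ((t - r) * x + (r - s) * y) / (t - s).
have ufE k : ht k u r = ((t - r) * ht k x s + (r - s) * ht k y t) / (t - s).
  by rewrite /ht /u; field; exact: lt0r_neq0.
suff W k : maximal k x s -> maximal k y t -> maximal k u r by exists u; split; apply: W.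
move=> kx ky l; rewrite !ufE ler_pM2r ?invr_gt0// lerD// ler_wpM2l// ?subr_ge0//.
Qed.

(** Adding the two maximality inequalities gives [0 <= (p j - p i) * (y - x)]. *)
Lemma maximal_mono i j x y t : maximal i x t -> maximal j y t -> x < y -> p i <= p j.
Proof.
move=> /(_ j) + /(_ i) => h1 h2 xy; rewrite leNgt; apply/negP => ji.
have : 0 < (p i - p j) * (y - x) by rewrite mulr_gt0 ?subr_gt0.
by move: h1 h2; rewrite /ht; lra.
Qed.

(** A positive combination [h'] of [ht i - ht j] and [ht k - ht j] is free of [x]. Affine in time
    and zero at two times, it vanishes identically, yet it is negative where [j] strictly
    dominates. *)
Lemma three_maximal i j k x s y t : p i < p j -> p j < p k -> s < t ->
  maximal i x s -> maximal j x s -> maximal k x s ->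
  maximal i y t -> maximal j y t -> maximal k y t -> False.
Proof.
move=> ij jk st ix jx kx iy jy ky.
have [x0 [t0 h]] := ess j.
have := maximal_eq ix jx; have := maximal_eq jx kx.
have := maximal_eq iy jy; have := maximal_eq jy ky.
have hi : ht i x0 t0 < ht j x0 t0 by apply: h; apply: contraTneq ij => ->; rewrite ltxx.
have hk : ht k x0 t0 < ht j x0 t0 by apply: h; apply: contraTneq jk => ->; rewrite ltxx.
pose h' u v := (p k - p j) * (ht i u v - ht j u v) + (p j - p i) * (ht k u v - ht j u v).
have hlt : h' x0 t0 < 0.
  rewrite /h'; have : 0 < (p k - p j) * (ht j x0 t0 - ht i x0 t0) by rewrite mulr_gt0 ?subr_gt0.
  have : 0 < (p j - p i) * (ht j x0 t0 - ht k x0 t0) by rewrite mulr_gt0 ?subr_gt0.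
  lra.
move=> e1 e2 e3 e4.
have z1 : h' x s = 0 by rewrite /h' e4 e3 subrr !mulr0 addr0.
have z2 : h' y t = 0 by rewrite /h' e2 e1 subrr !mulr0 addr0.
pose c := (p k - p j) * (q i - q j) + (p j - p i) * (q k - q j).
have hc u v u' v' : h' u v - h' u' v' = c * (v - v') by rewrite /h' /ht /c; ring.
have c0 : c = 0.
  have := hc x s y t; rewrite z1 z2 subrr => /esym/eqP; rewrite mulf_eq0.
  by move=> /orP[/eqP//|]; rewrite subr_eq0 => /eqP e; move: st; rewrite e ltxx.
by have := hc x0 t0 x s; rewrite c0 mul0r z1 subr0 => e; move: hlt; rewrite e ltxx.
Qed.

(* Two edges meeting the same two sweep lines coincide unless one of them lies
   weakly to the right of the other. *)
Lemma edge_uniq i j i' j' s t : p i < p j -> p i' < p j' ->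
  p i < p j' -> p i' < p j -> s < t ->
  tie i j s -> tie i' j' s -> tie i j t -> tie i' j' t -> i = i' /\ j = j'.
Proof.
move=> ij ij' hij' hi'j st.
(* If the two tie points differed, a slope of the left pair would be at most one of the right pair,
   against a cross inequality. *)
have samept r x x' : maximal i x r -> maximal j x r -> maximal i' x' r -> maximal j' x' r -> x = x'.
  move=> ix jx ix' jx'; case: (ltgtP x x') => // xx'.
    by have := maximal_mono jx ix' xx'; rewrite leNgt hi'j.
  by have := maximal_mono jx' ix xx'; rewrite leNgt hij'.
move=> [x [ix jx]] [x' [ix' jx']] [y [iy jy]] [y' [iy' jy']].
move: (samept _ _ _ ix jx ix' jx') (samept _ _ _ iy jy iy' jy') => ? ?; subst x' y'.
(* The tie points now coincide, so pairs that differ would leave three functions tied at both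
   times. *)
have T k l m : p k < p l -> p l < p m -> maximal k x s -> maximal l x s -> maximal m x s ->
    maximal k y t -> maximal l y t -> maximal m y t -> False.
  by move=> kl lm; apply: three_maximal.
split.
  case: (ltgtP (p i) (p i')) => [h|h|/p_inj//]; exfalso.
    exact: (T i i' j).
  exact: (T i' i j').
case: (ltgtP (p j) (p j')) => [h|h|/p_inj//]; exfalso.
  exact: (T i j j').
exact: (T i j' j).
Qed.

(* Two nondegenerate time intervals that are both initial in l share a
   nondegenerate interval. *)
Lemma initial_overlap i j i' j' (l : R -> Prop) :
  sweep_edge i j -> sweep_edge i' j' ->
  (forall t, tie i j t -> l t) -> (forall t, tie i' j' t -> l t) ->
  (forall t, l t -> exists2 s, tie i j s & s <= t) ->
  (forall t, l t -> exists2 s, tie i' j' s & s <= t) ->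
  exists s t, [/\ s < t, tie i j s, tie i' j' s, tie i j t & tie i' j' t].
Proof.
move=> [ij [s1 [t1 [st1 as1 at1]]]] [ij' [s2 [t2 [st2 as2 at2]]]] l1 l2 m1 m2.
have low k k' s s' : tie k k' s -> (exists2 r, tie k k' r & r <= s') ->
    exists r, [/\ tie k k' r, r <= s & r <= s'].
  move=> ks [r kr rs']; have [rs|/ltW sr] := leP r s; first by exists r.
  by exists s; split => //; exact: le_trans rs'.
have [r1 [ar1 r11 r12]] := low _ _ _ _ as1 (m1 _ (l2 _ as2)).
have [r2 [ar2 r22 r21]] := low _ _ _ _ as2 (m2 _ (l1 _ as1)).
(* Each of [r1], [r2] is at most both [s1] and [s2], hence strictly below [t1] and [t2]. *)
exists (Num.max r1 r2), (Num.min t1 t2); split.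
- rewrite lt_min !gt_max; lra.
- by apply: (tie_between _ _ ar1 at1); rewrite ?le_max ?ge_max ?lexx//=; lra.
- by apply: (tie_between _ _ ar2 at2); rewrite ?le_max ?ge_max ?lexx ?orbT//=; lra.
- by apply: (tie_between _ _ ar1 at1); rewrite ?le_min ?ge_min ?lexx//=; lra.
- by apply: (tie_between _ _ ar2 at2); rewrite ?le_min ?ge_min ?lexx ?orbT//=; lra.
Qed.

(* Where an edge between regions i and j starts, some third function k ties with
   both and dominates them just before.  If k is left of i (or if there is no
   such k), region i starts there too; if k is right of j, region j starts
   there; otherwise region k ends there. *)
Lemma edge_start i j : sweep_edge i j ->
  [\/ (forall t, live i t -> exists2 s, tie i j s & s <= t),
      ((exists t0, forall t, live j t -> t0 <= t) /\
        (forall t, live j t -> exists2 s, tie i j s & s <= t))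
    | (exists k t0, [/\ [/\ p i < p k, p k < p j & live k t0], tie i j t0,
        (forall t, live k t -> t <= t0) & (forall t, tie i j t -> t0 <= t)])].
Proof.
move=> [ij [s1 [t1 [st1 as1 at1]]]].
have pij : 0 < p j - p i by rewrite subr_gt0.
have pij0 : p j - p i != 0 by exact: lt0r_neq0.
(* [X t] is where [ht i] and [ht j] agree at time [t]. The margin [D k t] of their common value over
   [k] is affine in [t] with slope [al k], and the pair is tied exactly when all margins are
   nonnegative. *)
pose X t := - ((q j - q i) * t + (a j - a i)) / (p j - p i).
have fX t : ht i (X t) t = ht j (X t) t by rewrite /ht /X; field.
pose D k t := ht i (X t) t - ht k (X t) t.
pose al k := D k 1 - D k 0.
have Dal k s t : D k t - D k s = al k * (t - s).
  by rewrite /al /D /ht /X; field.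
have tieP t : tie i j t <-> forall k, 0 <= D k t.
  split=> [[x [ix jx]] k|h].
    have := maximal_eq ix jx; rewrite /ht => e.
    have -> : D k t = ht i x t - ht k x t; last by rewrite subr_ge0.
    rewrite /D; suff -> : X t = x by [].
    by apply: (mulIf pij0); rewrite /X divfK//; lra.
  by exists (X t); split=> k; have := h k; rewrite /D -?fX subr_ge0.
have [/existsP[k0 k0P]|/existsPn nk] := boolP [exists k, 0 < al k]; last first.
  (* No margin increases, so the edge extends back to time -oo. *)
  constructor 1 => t _; exists (Num.min t s1); last by rewrite ge_min lexx.
  apply/tieP => k; have /tieP/(_ k) := as1; have := Dal k s1 (Num.min t s1).
  have := nk k; rewrite -leNgt => ak.
  have : 0 <= al k * (Num.min t s1 - s1).
    by rewrite mulr_le0// subr_le0 ge_min lexx orbT.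
  lra.
(* The zero of an increasing margin; the edge starts at the latest of these zeros. *)
pose z k := s1 - D k s1 / al k.
have Dz k : 0 < al k -> D k (z k) = 0.
  move=> ak; have := Dal k s1 (z k); rewrite /z => /eqP; rewrite subr_eq => /eqP ->.
  by field; exact: lt0r_neq0.
have [k ak kmax] : exists2 k, 0 < al k & forall l, 0 < al l -> z l <= z k.
  by case: (@arg_maxP _ _ _ k0 (fun k => 0 < al k) z k0P) => k ? ?; exists k.
set t0 := z k; have Dk0 : D k t0 = 0 := Dz _ ak.
have Dlt t : t < t0 -> D k t < 0.
  move=> tt; have := Dal k t t0; rewrite Dk0.
  have : 0 < al k * (t0 - t) by rewrite mulr_gt0// subr_gt0.
  lra.
have Dgt t : t0 < t -> 0 < D k t.
  move=> tt; have := Dal k t0 t; rewrite Dk0.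
  have : 0 < al k * (t - t0) by rewrite mulr_gt0// subr_gt0.
  lra.
have t0low t : tie i j t -> t0 <= t.
  by move=> /tieP/(_ k) h; rewrite leNgt; apply/negP => /Dlt; lra.
have at0 : tie i j t0.
  apply/tieP => l; have [al0|al0] := ltP 0 (al l).
    have := Dal l (z l) t0; rewrite Dz//.
    have : 0 <= al l * (t0 - z l) by rewrite mulr_ge0 ?(ltW al0)// subr_ge0 kmax.
    lra.
  have := Dal l s1 t0; have /tieP/(_ l) := as1.
  have : 0 <= al l * (t0 - s1) by rewrite mulr_le0// subr_le0 t0low.
  lra.
have ki : p k != p i.
  apply: contraTneq ak => /p_inj ->; rewrite /al /D; lra.
have kj : p k != p j.
  apply: contraTneq ak => /p_inj ->; rewrite /al /D -!fX; lra.
have fk x t : ht k x t = ht k (X t) t + p k * (x - X t) by rewrite /ht; ring.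
have fi x t : ht i x t = ht i (X t) t + p i * (x - X t) by rewrite /ht; ring.
have fj x t : ht j x t = ht i (X t) t + p j * (x - X t) by rewrite fX /ht; ring.
have mulr_sg (u u' v v' : R) : u < u' -> v <= v' -> 0 <= (u' - u) * (v' - v).
  by move=> uu vv; rewrite mulr_ge0// subr_ge0// ltW.
case: (ltgtP (p k) (p i)) ki => // [ki _|ki _].
  (* Before [t0], region [i] is empty: it is beaten by [k] left of [X t] and by [j] to the right. *)
  constructor 1 => t [x xt]; exists t0 => //; rewrite leNgt; apply/negP => /Dlt.
  rewrite /D; have := xt k; have := xt j; rewrite fi fj fk.
  have [xX|xX] := leP x (X t).
    have := mulr_sg _ _ _ _ ki xX; lra.
  have := mulr_gt0 pij (_ : 0 < x - X t); lra.
case: (ltgtP (p k) (p j)) kj => // [kj _|kj _]; last first.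
  have lj t : live j t -> t0 <= t.
    move=> [x xt]; rewrite leNgt; apply/negP => /Dlt.
    rewrite /D; have := xt k; have := xt i; rewrite fi fj fk.
    have [xX|xX] := ltP x (X t).
      have := mulr_gt0 pij (_ : 0 < X t - x); lra.
    have := mulr_sg _ _ _ _ kj xX; lra.
  by constructor 2; split; [exists t0 | move=> t /lj; exists t0].
constructor 3; exists k, t0; do 2?split => //; last first.
  (* After [t0], [k] is squeezed out: it lies below [i] left of [X t] and below [j] to the right. *)
  move=> t [x xt]; rewrite leNgt; apply/negP => /Dgt.
  rewrite /D; have := xt j; have := xt i; rewrite fi fj fk.
  have [xX|/ltW xX] := leP x (X t).
    have := mulr_sg _ _ _ _ ki xX; lra.
  have := mulr_sg _ _ _ _ kj xX; lra.
exists (X t0) => l; have /tieP/(_ l) := at0; move: Dk0; rewrite /D; lra.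
Qed.


Lemma live_total (i0 : I) t : exists i, live i t.
Proof.
by case: (@arg_maxP _ _ _ i0 xpredT (fun i => ht i 0 t)) => // i _ h; exists i, 0 => k; exact: h.
Qed.

(** Some region is alive at every time and there are finitely many, so their lifetimes are not all
    bounded below. *)
Lemma live_unbounded_below (i0 : I) : exists i, forall m, exists2 t, live i t & t < m.
Proof.
apply: contrapT => /forallNP H.
have /choice[b bP] : forall i, exists m, forall t, live i t -> m <= t.
  move=> i; have /existsNP[m /forall2NP mP] := H i; exists m => t it.
  by rewrite leNgt; apply/negP => tm; case: (mP t).
have [M MP] := fin_bounded b.
have [i] := live_total i0 (- M - 1).
by move/bP; have := MP i; rewrite ler_norml; lra.
Qed.

Lemma live_unbounded_above (i0 : I) : exists i, forall m, exists2 t, live i t & m < t.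
Proof.
apply: contrapT => /forallNP H.
have /choice[b bP] : forall i, exists m, forall t, live i t -> t <= m.
  move=> i; have /existsNP[m /forall2NP mP] := H i; exists m => t it.
  by rewrite leNgt; apply/negP => tm; case: (mP t).
have [M MP] := fin_bounded b.
have [i] := live_total i0 (M + 1).
by move/bP; have := MP i; rewrite ler_norml; lra.
Qed.

Lemma tie_live i j t : tie i j t -> live i t /\ live j t.
Proof. by move=> [x [ix jx]]; split; exists x. Qed.

(* Each kind of start charges injectively to the regions, and misses one of them:
   the rightmost region alive at time -oo, a region alive at time -oo, and a
   region alive at time +oo, respectively. *)
Lemma card_edges :
  (#|[set e : I * I | `[< sweep_edge e.1 e.2 >]]%SET| <= 3 * #|I|.-1)%N.
Proof.
have [->|[e0 _]] := set_0Vmem [set e : I * I | `[< sweep_edge e.1 e.2 >]]%SET.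
  by rewrite cards0.
have i0 := e0.1.
pose startL (e : I * I) := forall t, live e.1 t -> exists2 s, tie e.1 e.2 s & s <= t.
pose startR (e : I * I) := (exists t0, forall t, live e.2 t -> t0 <= t) /\
  forall t, live e.2 t -> exists2 s, tie e.1 e.2 s & s <= t.
pose startM (e : I * I) k := exists t0,
  [/\ [/\ p e.1 < p k, p k < p e.2 & live k t0], tie e.1 e.2 t0,
      (forall t, live k t -> t <= t0) & (forall t, tie e.1 e.2 t -> t0 <= t)].
pose E (Q : I * I -> Prop) := [set e : I * I | `[< sweep_edge e.1 e.2 /\ Q e >]]%SET.
have EP Q e : reflect (sweep_edge e.1 e.2 /\ Q e) (e \in E Q).
  by rewrite inE; exact: asboolP.
have inj_card Q (h : I * I -> I) i : {in E Q &, injective h} ->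
    (forall e, sweep_edge e.1 e.2 -> Q e -> h e != i) -> (#|E Q| <= #|I|.-1)%N.
  move=> hi hn; rewrite -(card_in_imset hi) -(cardC1 i); apply/subset_leq_card/fintype.subsetP => x.
  by case/imsetP => e /EP[e1 e2] ->; rewrite !inE; exact: hn.
have cL : (#|E startL| <= #|I|.-1)%N.
  have [i iP] : exists2 i, (forall m, exists2 t, live i t & t < m) &
      forall j, (forall m, exists2 t, live j t & t < m) -> p j <= p i.
    have [i1 /asboolP i1P] := live_unbounded_below i0.
    case: (@arg_maxP _ _ _ i1 (fun i => `[< forall m, exists2 t, live i t & t < m >]) p i1P).
    by move=> i /asboolP ? h; exists i => // j /asboolP; exact: h.
  move=> imax; apply: (@inj_card _ fst i).
    move=> [k j] [k' j'] /EP[e1 s1] /EP[e2 s2] /= kk; subst k'.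
    have l1 t : tie k j t -> live k t by case/tie_live.
    have l2 t : tie k j' t -> live k t by case/tie_live.
    have [s [t [st b1 b2 b3 b4]]] := initial_overlap e1 e2 l1 l2 s1 s2.
    have [e1p _] := e1; have [e2p _] := e2.
    by have [_ /= ->] := edge_uniq e1p e2p e2p e1p st b1 b2 b3 b4.
  move=> [k j] /= [kj _] st; apply/negP => /eqP e; subst k.
  (* A charge to [i] would make [j], of larger slope, alive at arbitrarily early times too. *)
  move: kj; rewrite ltNge /= => /negP; apply; apply: imax => m.
  have [t it tm] := iP m; have [s sa sle] := st _ it.
  by exists s; [case/tie_live: sa | exact: le_lt_trans tm].
have cR : (#|E startR| <= #|I|.-1)%N.
  have [i iP] := live_unbounded_below i0.
  apply: (@inj_card _ snd i).
    move=> [k j] [k' j'] /EP[e1 [_ s1]] /EP[e2 [_ s2]] /= kk; subst j'.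
    have l1 t : tie k j t -> live j t by case/tie_live.
    have l2 t : tie k' j t -> live j t by case/tie_live.
    have [s [t [st b1 b2 b3 b4]]] := initial_overlap e1 e2 l1 l2 s1 s2.
    have [e1p _] := e1; have [e2p _] := e2.
    by have [/= -> _] := edge_uniq e1p e2p e1p e2p st b1 b2 b3 b4.
  move=> [k j] /= _ [[t0 t0P] _]; apply/negP => /eqP e; subst j.
  by have [t it] := iP t0; rewrite ltNge t0P.
have cM : (#|E (fun e => exists k, startM e k)| <= #|I|.-1)%N.
  have [i iP] := live_unbounded_above i0.
  have /choice[h hP] : forall e, exists k, (exists k, startM e k) -> startM e k.
    move=> e; have [[k kP]|n] := pselect (exists k, startM e k); first by exists k.
    by exists i0.
  apply: (@inj_card _ h i).
    move=> [k j] [k' j'] /EP[e1 /hP s1] /EP[e2 /hP s2] kk.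
    move: s1 s2; rewrite -kk; set m := h _.
    move=> [t1 [[km mj m1] a1 m1' t1P]] [t2 [[km' mj' m2] a2 m2' t2P]].
    (* Both edges start at the last moment of the same region [m]; its slope lies between those of
       either pair, which yields the cross inequalities. *)
    have tt : t2 = t1 by apply/eqP; rewrite eq_le m1'// m2'.
    subst t2.
    have l1 t : t1 <= t -> exists2 s, tie k j s & s <= t by exists t1.
    have l2 t : t1 <= t -> exists2 s, tie k' j' s & s <= t by exists t1.
    have [s [t [st b1 b2 b3 b4]]] := initial_overlap e1 e2 t1P t2P l1 l2.
    have [e1p _] := e1; have [e2p _] := e2.
    by have [/= -> /= ->] := edge_uniq e1p e2p (lt_trans km mj') (lt_trans km' mj) st b1 b2 b3 b4.
  move=> e _ /hP[t0 [_ _ t0P _]]; apply/negP => /eqP ei.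
  by have [t it] := iP t0; rewrite ltNge t0P// ei.
apply: (@leq_trans #|E startL :|: E startR :|: E (fun e => exists k, startM e k)|).
  apply/subset_leq_card/fintype.subsetP => e; rewrite inE => /asboolP ee.
  rewrite !finset.in_setU; have [h|h|h] := edge_start ee; apply/orP.
  - by left; apply/orP; left; apply/EP; split.
  - by left; apply/orP; right; apply/EP; split.
  - by right; apply/EP; split.
rewrite mulSn mulSn mul1n addnA.
apply: leq_trans (leq_card_setU _ _) _; apply: leq_add => //.
by apply: leq_trans (leq_card_setU _ _) _; apply: leq_add.
Qed.

End Sweep.

(** * Regions of a tropical hypersurface *)

Section Dot.
Variables (R : realType) (d : nat).
Implicit Types (b x y : 'rV[R]_d) (t : R).

Lemma dotDr b x y : dot b (x + y) = dot b x + dot b y.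
Proof. by rewrite /dot -big_split; apply: eq_bigr => i _; rewrite mxE mulrDr. Qed.

Lemma dotZr b t x : dot b (t *: x) = t * dot b x.
Proof. by rewrite /dot mulr_sumr; apply: eq_bigr => i _; rewrite mxE mulrCA. Qed.

Lemma dotC x y : dot x y = dot y x.
Proof. by apply: eq_bigr => i _; rewrite mulrC. Qed.

Lemma dotBr b x y : dot b (x - y) = dot b x - dot b y.
Proof. by rewrite -scaleN1r dotDr dotZr mulN1r. Qed.

Lemma dotBl x y b : dot (x - y) b = dot x b - dot y b.
Proof. by rewrite ![dot _ b]dotC dotBr. Qed.

Lemma dotNl b x : dot (- b) x = - dot b x.
Proof. by rewrite dotC -scaleN1r dotZr mulN1r dotC. Qed.

Lemma dot0l x : dot 0 x = 0.
Proof. by rewrite /dot big1// => i _; rewrite mxE mul0r. Qed.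

Lemma dot_self_eq0 x : (dot x x == 0) = (x == 0).
Proof.
apply/eqP/eqP => [h|->]; last by apply: big1 => i _; rewrite mxE mul0r.
apply/rowP => i; rewrite mxE; apply/eqP; rewrite -sqrf_eq0 expr2.
have /allP/(_ i) : all (fun i : 'I_d => true ==> (x 0 i * x 0 i == 0)) (index_enum 'I_d).
  by rewrite -psumr_eq0 ?[X in X == 0]h// => j _; rewrite -expr2 sqr_ge0.
by apply; rewrite mem_index_enum.
Qed.

Lemma dot_continuous b : continuous (dot b).
Proof.
apply: continuous_big => [|i _]; first exact: add_continuous.
by move=> x; apply: continuousM; [exact: cst_continuous | exact: coord_continuous].
Qed.

Lemma near_ray x w (P : set 'rV[R]_d) : (\forall y \near x, P y) ->
  exists2 e : R, 0 < e & forall t : R, `|t| < e -> P (x + t *: w).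
Proof.
move=> xP.
have : (x + t *: w) @[t --> (0 : R)] --> x.
  rewrite -[X in _ --> X]addr0 -[X in _ + X](scale0r w).
  by apply: cvgD; [exact: cvg_cst | apply: cvgZr_tmp; exact: cvg_id].
move=> /(_ _ xP) /nbhs_normP[e /= e0 eP]; exists e => // t te.
by apply: eP; rewrite /= sub0r normrN.
Qed.

(** A small step from [x] along [u - v] raises the first function over the second by a positive
    multiple of [dot (u - v) (u - v)]. *)
Lemma near_affine_le u c v e x : (\forall y \near x, dot u y + c <= dot v y + e) ->
  dot u x + c = dot v x + e -> u = v.
Proof.
move=> /(@near_ray x (u - v))[r r0 rP] xE.
have := rP (r / 2); rewrite gtr0_norm ?divr_gt0// => /(_ _)/wrap[|h]; first lra.
have : 0 <= dot (u - v) (u - v) by apply: sumr_ge0 => i _; rewrite -expr2 sqr_ge0.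
rewrite le_eqVlt => /orP[|p].
  by rewrite eq_sym dot_self_eq0 subr_eq0 => /eqP.
exfalso; have := mulr_gt0 (_ : 0 < r / 2) p; rewrite !dotBl !dotBr.
move: h; rewrite !dotDr !dotZr !dotBr; lra.
Qed.
End Dot.

Lemma card_fset_set_seq (T : choiceType) (s : seq T) : uniq s ->
  #|` fset_set [set` s]| = size s.
Proof.
move=> us; apply/perm_size/uniq_perm => // x.
rewrite in_fset_set; first by apply/idP/idP; rewrite inE.
exact: finite_seq.
Qed.

Section Pieces.
Variables (R : realType) (d : nat) (I : finType).
Variables (b : I -> 'rV[R]_d) (a : I -> R).
Let aff i x := dot (b i) x + a i.

Definition region i := [set x | forall j, j != i -> aff j x < aff i x].

Lemma region_open i : open (region i).
Proof.
have aff_cont j : continuous (aff j).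
  by move=> x; apply: continuousD; [exact: dot_continuous | exact: cst_continuous].
have -> : region i = ~` \bigcup_(j in [set j | j != i]) [set x | aff i x - aff j x <= 0].
  apply/seteqP; split=> [x xi [j /= ji]|x xi j ji].
    by rewrite subr_le0 leNgt xi.
  by rewrite ltNge; apply/negP => h; apply: xi; exists j => //=; rewrite subr_le0.
apply: closed_openC; apply: closed_bigcup => [|j _]; first exact: finite_finset.
apply: (@preimage_closed _ _ (fun x => aff i x - aff j x) [set t | t <= 0]); last exact: closed_le.
by move=> x _; apply: continuousB; exact: aff_cont.
Qed.

Lemma region_disjoint i j x : region i x -> region j x -> i = j.
Proof.
move=> xi xj; apply/eqP/negP => /negP ij.
by have := lt_trans (xj i ij) (xi j _); rewrite ltxx eq_sym => /(_ ij).
Qed.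

Lemma region_connected i : connected (region i).
Proof.
have [[x xi]|] := pselect (region i !=set0); last first.
  by move=> /nonemptyPn ->; exact: connected0.
pose seg y := (fun t : R => x + t *: (y - x)) @` `[0, 1].
have -> : region i = \bigcup_(y in region i) seg y.
  apply/seteqP; split=> [y yi|y [z zi [t /= + <-]]].
    exists y => //; exists 1; first by rewrite /= in_itv/= ler01 lexx.
    by rewrite scale1r addrC subrK.
  rewrite in_itv/= => /andP[t0 t1] j ji; rewrite /aff !dotDr !dotZr !dotBr.
  have := xi j ji; have := zi j ji; rewrite /aff => h1 h2.
  have [t1'|t1'] := ltP t 1.
    have := mulr_gt0 (_ : 0 < 1 - t) (_ : 0 < (dot (b i) x + a i) - (dot (b j) x + a j)).
    have := mulr_ge0 t0 (_ : 0 <= (dot (b i) z + a i) - (dot (b j) z + a j)).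
    lra.
  have -> : t = 1 by lra.
  lra.
apply: bigcup_connected.
  exists x => y yi; exists 0; first by rewrite /= in_itv/= ler01 lexx.
  by rewrite scale0r addr0.
move=> y yi; apply: connected_continuous_connected; first exact: segment_connected.
apply: continuous_subspaceT => t.
by apply: cvgD; [exact: cvg_cst | apply: cvgZr_tmp; exact: cvg_id].
Qed.

Hypothesis region_neq0 : forall i, region i !=set0.

Lemma piece_inj : injective b.
Proof.
move=> i j bij; apply/eqP/negP => /negP ij.
have [x xi] := region_neq0 i; have [y yj] := region_neq0 j.
have := xi j; rewrite eq_sym => /(_ ij); have := yj i ij; rewrite /aff bij; lra.
Qed.

(** Each region is connected, open, and relatively closed since the others are open, hence a
    component. *)
Lemma mComp_regions (Z : wcomplex R d) :
  ~` supp Z = \bigcup_i region i -> mComp Z = #|I|.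
Proof.
move=> ZE; rewrite /mComp.
have compE i x : region i x -> connected_component (~` supp Z) x = region i.
  move=> xi; apply/seteqP; split; last first.
    apply: connected_component_max => //; last exact: region_connected.
    by rewrite ZE => y yi; exists i.
  set C := connected_component _ x.
  have CZ : C `<=` \bigcup_i region i by rewrite -ZE; exact: connected_component_sub.
  suff <- : C `&` region i = C by apply: subIsetr.
  apply: (component_connected (A := ~` supp Z) (x := x)).
  - exists x; split=> //; apply: connected_component_refl.
    by rewrite ZE; exists i.
  - by exists (region i) => //; exact: region_open.
  exists (~` \bigcup_(j in [set j | j != i]) region j).
    by apply: open_closedC; apply: bigcup_open => j _; exact: region_open.
  apply/seteqP; split=> y [yC yi]; split=> //.
    by move=> [j /= ji yj]; move: ji; rewrite (region_disjoint yj yi) eqxx.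
  have [j _ yj] := CZ _ yC; have [<-//|ji] := eqVneq j i.
  by case: yi; exists j.
have -> : [set C | exists2 x, ~ supp Z x & C = connected_component (~` supp Z) x]
    = [set` [seq region i | i <- enum I]].
  apply/seteqP; split=> [C [x nx ->]|C /= /mapP[i _ ->]].
    have : (\bigcup_i region i) x by rewrite -ZE.
    by move=> [i _ xi]; rewrite (compE _ _ xi) /=; apply/mapP; exists i => //; rewrite mem_enum.
  have [x xi] := region_neq0 i; exists x; last by rewrite (compE _ _ xi).
  have : (\bigcup_i region i) x by exists i.
  by rewrite -ZE.
rewrite card_fset_set_seq; first by rewrite size_map -cardE.
rewrite map_inj_uniq ?enum_uniq// => i j ij.
by have [x xi] := region_neq0 i; apply: (region_disjoint xi); rewrite -ij.
Qed.

Variable g : 'rV[R]_d -> R.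
Hypothesis g_ge : forall x i, aff i x <= g x.
Hypothesis g_att : forall x, exists i, g x = aff i x.

Lemma regionP x i : aff i x = g x ->
  region i x \/ exists2 j, j != i & aff j x = g x.
Proof.
move=> xi; have [|/existsNP[j /not_implyP[ji]]] := pselect (region i x); first by left.
by move=> /negP; rewrite -leNgt xi => h; right; exists j => //; apply/eqP; rewrite eq_le g_ge.
Qed.

(** Where [g] is affine, every piece attaining it touches it from below and so has its gradient;
    gradients being distinct, only one piece attains. *)
Lemma supp_Vcomplex : ~` supp (Vcomplex g) = \bigcup_i region i.
Proof.
apply/seteqP; split=> [x /contrapT[v [e ve]]|x [i _ xi] /=].
  have slope i : aff i x = g x -> b i = v.
    move=> xi; apply: (@near_affine_le _ _ _ (a i) _ e x); last first.
      by rewrite -[LHS]/(aff i x) xi; exact: (nbhs_singleton ve).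
    by apply: filterS ve => y <-; exact: g_ge.
  have [i /esym xi] := g_att x; exists i => //.
  have [//|[j ji xj]] := regionP xi.
  by move: ji; rewrite (piece_inj (etrans (slope _ xi) (esym (slope _ xj)))) eqxx.
apply; exists (b i), (a i).
have : nbhs x (region i) by apply: open_nbhs_nbhs; split => //; exact: region_open.
apply: filterS => y yi; have [j yj] := g_att y; rewrite yj.
have [->//|ji] := eqVneq j i.
by have := g_ge y i; rewrite yj leNgt yi.
Qed.
End Pieces.

(** Keep a minimal index set that attains the maximum everywhere. A point where deleting [j] breaks
    this is a point where [j] strictly dominates. *)
Lemma irredundant (R : realType) (d : nat) (g : 'rV[R]_d -> R) :
  tropical_polynomial g ->
  exists (I : finType) (b : I -> 'rV[R]_d) (a : I -> R),
   [/\ forall i, region b a i !=set0,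
       forall x i, dot (b i) x + a i <= g x
     & forall x, exists i, g x = dot (b i) x + a i].
Proof.
move=> [n [b [a gE]]].
pose F x i := dot (b i) x + a i.
pose P (J : {set 'I_n.+1}) := `[< forall x, exists2 j, j \in J & forall i, F x i <= F x j >].
have [J /minsetP[/asboolP JP Jmin]] : {J | minset P J}.
  apply: ex_minset; exists [set: 'I_n.+1]%SET; apply/asboolP => x.
  by case: (@arg_maxP _ _ _ ord0 xpredT (F x)) => // i _ h; exists i => // j; exact: h.
have gF x j : (forall i, F x i <= F x j) -> g x = F x j.
  move=> h; apply/eqP; rewrite gE eq_le; apply/andP; split.
    by apply/bigmax_leP; split => [|i _]; exact: h.
  by apply/bigmax_geP; right; exists j.
exists {j | j \in J}, (b \o val), (a \o val); split.
- move=> [j jJ].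
  have : ~~ P (J :\ j)%SET.
    by apply/negP => /Jmin -/(_ (subD1set _ _)) /setP/(_ j); rewrite !inE eqxx jJ.
  move=> /asboolPn/existsNP[x /forall2NP xP]; exists x => -[k kJ].
  rewrite -val_eqE /= => kj.
  have [j0 j0J j0P] := JP x.
  have e : j0 = j.
    apply/eqP; apply: contrapT => /negP e; case: (xP j0) => //.
    by rewrite !inE e j0J.
  case: (xP k) => [|/existsNP [i /negP]]; first by rewrite !inE kj kJ.
  by rewrite -ltNge -/(F x k) -/(F x j) => /lt_le_trans; apply; rewrite -e.
- move=> x [j jJ] /=; have [k _ kP] := JP x; rewrite (gF _ _ kP); exact: kP.
- by move=> x; have [k kJ kP] := JP x; exists (exist _ k kJ); rewrite (gF _ _ kP).
Qed.

Lemma infinite_two_points (T : choiceType) (A : set T) : infinite_set A ->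
  exists x y, [/\ A x, A y & x != y].
Proof.
move=> iA; have [x Ax] := infinite_setN0 iA.
have [y [Ay /eqP yx]] := infinite_setN0 (infinite_setD iA (finite_set1 x)).
by exists x, y; rewrite eq_sym.
Qed.

(** * Lines *)

Section Plane.
Variable R : realType.
Implicit Types (x y z b : 'rV[R]_2) (L : set 'rV[R]_2).

Lemma dot2 b x : dot b x = b 0 0 * x 0 0 + b 0 1 * x 0 1.
Proof.
rewrite /dot !big_ord_recl big_ord0 addr0.
by congr (_ + b 0 _ * x 0 _); exact: val_inj.
Qed.

Lemma row2P x y : x 0 0 = y 0 0 -> x 0 1 = y 0 1 -> x = y.
Proof.
move=> h0 h1; apply/rowP => -[[|[|//]] hi].
  by have -> : Ordinal hi = 0 by exact: val_inj.
by have -> : Ordinal hi = 1 by exact: val_inj.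
Qed.

(** The right-hand side depends on the two points alone, so lines sharing two points become equal by
    rewriting. *)
Lemma hyperplane_through L x y : hyperplane L -> L x -> L y -> x != y ->
  L = [set z | (z 0 0 - x 0 0) * (y 0 1 - x 0 1)
             = (z 0 1 - x 0 1) * (y 0 0 - x 0 0)].
Proof.
move=> [b [c [b0 ->]]] /=; rewrite !dot2 => xL yL xy.
have bw : b 0 0 * (y 0 0 - x 0 0) = - (b 0 1 * (y 0 1 - x 0 1)) by lra.
apply/seteqP; split=> z /=; rewrite dot2 => zL.
  have bz : b 0 0 * (z 0 0 - x 0 0) = - (b 0 1 * (z 0 1 - x 0 1)) by lra.
  have [b00|b00] := eqVneq (b 0 0) 0.
    have b1 : b 0 1 != 0.
      by apply: contraNneq b0 => b1; apply/eqP/row2P; rewrite mxE.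
    have w1 : y 0 1 - x 0 1 = 0.
      by apply: (mulfI b1); move: bw; rewrite b00 !mul0r mulr0; lra.
    have z1 : z 0 1 - x 0 1 = 0.
      by apply: (mulfI b1); move: bz; rewrite b00 !mul0r mulr0; lra.
    by rewrite w1 z1 mulr0 mul0r.
  apply: (mulfI b00); rewrite mulrA bz [RHS]mulrCA bw; ring.
set u := z 0 0 - x 0 0 in zL; set v := z 0 1 - x 0 1 in zL.
suff h : b 0 0 * u + b 0 1 * v = 0 by move: h; rewrite /u /v; lra.
have [w0|w0] := eqVneq (y 0 0 - x 0 0) 0.
  have w1 : y 0 1 - x 0 1 != 0.
    apply: contraNneq xy => w1; apply/eqP/row2P; lra.
  have u0 : u = 0 by apply: (mulIf w1); rewrite zL w0 mulr0 mul0r.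
  have b1 : b 0 1 = 0 by apply: (mulIf w1); move: bw; rewrite w0 mulr0 mul0r; lra.
  by rewrite u0 b1 mulr0 mul0r addr0.
apply: (mulIf w0); rewrite mulrDl mul0r -[b 0 1 * v * _]mulrA -zL.
by rewrite mulrAC bw; ring.
Qed.

(** Vectors with different second coordinates collide for a single [s], the quotient below; any [s]
    beyond all quotients works. *)
Lemma generic_shear (I : finType) (b : I -> 'rV[R]_2) : injective b ->
  exists s, injective (fun i => b i 0 0 + s * b i 0 1).
Proof.
move=> bI.
have [M MP] := fin_bounded (fun e : I * I =>
  (b e.2 0 0 - b e.1 0 0) / (b e.1 0 1 - b e.2 0 1)).
exists (M + 1) => i j h; apply: bI.
have [e|ne] := eqVneq (b i 0 1) (b j 0 1).
  by apply: row2P => //; move: h; rewrite e => /addIr.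
exfalso; have := MP (i, j) => /=.
have -> : (b j 0 0 - b i 0 0) / (b i 0 1 - b j 0 1) = M + 1.
  by apply: (mulIf (_ : b i 0 1 - b j 0 1 != 0)); rewrite ?subr_eq0// divfK ?subr_eq0//; lra.
rewrite ler_norml; lra.
Qed.

(** Infinite intersection is the hypothesis that survives splitting a finite union, over the
    summands later and over pairs of pieces here. *)
Lemma curve_lines (Z : wcomplex R 2) : tropical_hypersurface Z ->
  (0 < mComp Z)%N /\ exists s : seq (set 'rV[R]_2),
    (size s <= 3 * (mComp Z).-1)%N /\
    forall L, hyperplane L -> infinite_set (L `&` supp Z) -> L \in s.
Proof.
move=> [g /irredundant[I [b [a [rN0 gge gatt]]]] ->].
have suppE := supp_Vcomplex rN0 gge gatt.
rewrite (mComp_regions rN0 suppE).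
split; first by have [i _] := gatt 0; apply/card_gt0P; exists i.
have bI := piece_inj rN0.
have [r rI] := generic_shear bI.
(* Sweeping along [T] turns the slopes into the sheared coordinates, which are distinct. *)
pose p i := b i 0 0 + r * b i 0 1; pose q i : R := b i 0 1.
pose T z := z 0 1 - r * z 0 0.
have htE i z : ht p q a i (z 0 0) (T z) = dot (b i) z + a i.
  by rewrite /ht /T /p /q dot2; ring.
have ess i : exists (x t : R), forall j, j != i -> ht p q a j x t < ht p q a i x t.
  by have [z zi] := rN0 i; exists (z 0 0), (T z) => j ji; rewrite !htE; exact: zi.
pose line (e : I * I) := [set z | dot (b e.1) z + a e.1 = dot (b e.2) z + a e.2].
exists [seq line e | e <- enum [set e : I * I | `[< sweep_edge p q a e.1 e.2 >]]%SET].
split; first by rewrite size_map -cardE; exact: card_edges.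
move=> L hL iL.
pose ridge (e : I * I) := [set z | dot (b e.1) z + a e.1 = g z /\ dot (b e.2) z + a e.2 = g z].
have [e e12 ie] : exists2 e, e.1 != e.2 & infinite_set (L `&` ridge e).
  apply: contrapT => /forall2NP H; apply: iL.
  apply: (@sub_finite_set _ _ (\bigcup_(e in [set e | e.1 != e.2]) (L `&` ridge e))).
    move=> z [Lz Zz]; have [i /esym zi] := gatt z.
    have [zr|[j ji zj]] := regionP gge zi.
      have : (\bigcup_i region b a i) z by exists i.
      by rewrite -suppE.
    by exists (j, i).
  apply: bigcup_finite; first exact: finite_finset.
  by move=> e /= e12; case: (H e) => // /contrapT.
wlog pe : e e12 ie / p e.1 < p e.2.
  move=> W; have [h|h|h] := ltgtP (p e.1) (p e.2); first exact: (W e).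
    apply: (W (e.2, e.1)) => //=; first by rewrite eq_sym.
    by move: ie; congr (~ finite_set (L `&` _)); apply/seteqP; split=> z [].
  by move: e12; rewrite (rI _ _ h) eqxx.
have [x [y [[Lx [x1 x2]] [Ly [y1 y2]] xy]]] := infinite_two_points ie.
have ridge_tie z : ridge e z -> tie p q a e.1 e.2 (T z).
  by move=> [z1 z2]; exists (z 0 0); split=> k; rewrite !htE ?z1 ?z2.
apply/mapP; exists e.
  rewrite mem_enum inE; apply/asboolP; split=> //.
  have [xy'|yx|exy] := ltgtP (T x) (T y).
  - by exists (T x), (T y); split=> //; exact: ridge_tie.
  - by exists (T y), (T x); split=> //; exact: ridge_tie.
  (* At equal times the tie of two pieces with distinct slopes determines the point. *)
  exfalso; move/eqP: xy; apply.
  have e00 : x 0 0 = y 0 0.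
    have := htE e.1 x; have := htE e.2 x; have := htE e.1 y; have := htE e.2 y.
    rewrite x1 x2 y1 y2 exy /ht => h1 h2 h3 h4.
    have : (p e.2 - p e.1) * (x 0 0 - y 0 0) = 0 by lra.
    by move/eqP; rewrite mulf_eq0 !subr_eq0 (gt_eqF pe)/= => /eqP.
  by apply: row2P => //; move: exy; rewrite /T e00; lra.
have hl : hyperplane (line e).
  exists (b e.1 - b e.2), (a e.2 - a e.1); split.
    by rewrite subr_eq0; apply: contra_neq e12 => /bI.
  by apply/seteqP; split=> z /=; rewrite /line/= dotBl; lra.
rewrite (hyperplane_through hL Lx Ly xy) -(hyperplane_through hl _ _ xy)//.
  by rewrite /line/= x1 x2.
by rewrite /line/= y1 y2.
Qed.

End Plane.

(** The two sides are the regions of the pieces 0 and [dot b x - c]. *)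
Lemma mComp_hyperplane (R : realType) (d : nat) (Z : wcomplex R d) :
  hyperplane (supp Z) -> mComp Z = 2%N.
Proof.
move=> [b [c [b0 ZE]]].
pose bb (i : bool) := if i then b else 0.
pose aa (i : bool) := if i then - c else 0.
have rT : region bb aa true = [set x | c < dot b x].
  apply/seteqP; split=> x /=; rewrite /region /=.
    by move=> /(_ false isT); rewrite /bb /aa dot0l; lra.
  by move=> h [//|_]; rewrite /bb /aa dot0l; lra.
have rF : region bb aa false = [set x | dot b x < c].
  apply/seteqP; split=> x /=; rewrite /region /=.
    by move=> /(_ true isT); rewrite /bb /aa dot0l; lra.
  by move=> h [_|//]; rewrite /bb /aa dot0l; lra.
rewrite -card_bool; apply: (@mComp_regions _ _ _ bb aa).
  have bbp : dot b b != 0 by rewrite dot_self_eq0.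
  move=> [|]; rewrite ?rT ?rF.
    by exists (((c + 1) / dot b b) *: b); rewrite /= dotZr divfK//; lra.
  by exists (((c - 1) / dot b b) *: b); rewrite /= dotZr divfK//; lra.
rewrite ZE; apply/seteqP; split=> [x /= /eqP|x [i _]].
  rewrite neq_lt => /orP[h|h]; first by exists false => //; rewrite rF.
  by exists true => //; rewrite rT.
by case: i; rewrite ?rT ?rF /= => h e; move: h; rewrite e ltxx.
Qed.

(** * Relative interiors of facets and the faces of [Vplus phi] *)

Section Relint.
Variables (R : realType) (d : nat).
Implicit Types (S : set 'rV[R]_d).

Lemma sub_affspan S : S `<=` affspan S.
Proof.
move=> x Sx; exists 1%N, (fun=> 1), (fun=> x); split => //.
  by rewrite big_ord1.
by rewrite big_ord1 scale1r.
Qed.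

Lemma affspan_subsingleton S x y : (forall u v, S u -> S v -> u = v) ->
  affspan S x -> affspan S y -> x = y.
Proof.
move=> S1.
have sub z : affspan S z -> S z.
  move=> [[|k] [t [w [Sw t1 ->]]]].
    by move: t1; rewrite big_ord0 => /eqP; rewrite eq_sym oner_eq0.
  under eq_bigr => i _ do rewrite (S1 _ _ (Sw i) (Sw ord0)).
  by rewrite -scaler_suml t1 scale1r.
by move=> /sub Sx /sub Sy; exact: S1.
Qed.

Lemma polyhedron_segment S x y t : polyhedron S -> S x -> S y ->
  0 <= t -> t <= 1 -> S (x + t *: (y - x)).
Proof.
move=> [m [c [e ->]]] /= Sx Sy t0 t1 i; have := Sx i; have := Sy i.
rewrite dotDr dotZr dotBr => h1 h2.
have := mulr_ge0 t0 (_ : 0 <= e i - dot (c i) y).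
have := mulr_ge0 (_ : 0 <= 1 - t) (_ : 0 <= e i - dot (c i) x).
lra.
Qed.
End Relint.

Section Faces.
Variable R : realType.
Implicit Types (sigma : set 'rV[R]_2) (phi : 'rV[R]_2 -> R).

Lemma hyperplane_two_points (L : set 'rV[R]_2) : hyperplane L ->
  exists x y, [/\ L x, L y & x != y].
Proof.
move=> [b [c [b0 ->]]].
have bb : dot b b != 0 by rewrite dot_self_eq0.
pose w : 'rV[R]_2 := \row_i (if i == 0 then - b 0 1 else b 0 0).
have bw : dot b w = 0 by rewrite dot2 !mxE /=; ring.
have w0 : w != 0.
  apply: contraNneq b0 => /rowP w0; apply/eqP/row2P; rewrite mxE.
    by have := w0 1; rewrite !mxE /=.
  by have := w0 0; rewrite !mxE /= => /eqP; rewrite oppr_eq0 => /eqP.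
exists ((c / dot b b) *: b), ((c / dot b b) *: b + w); split => /=.
- by rewrite dotZr divfK.
- by rewrite dotDr dotZr divfK// bw addr0.
- by rewrite -subr_eq0 opprD addrA subrr add0r oppr_eq0.
Qed.

(** The affine hull is the line through [x] and [y]; an open slab orthogonal to [y - x] cuts it in
    the open segment, which lies in [sigma] by convexity. *)
Lemma segment_relint sigma x y t : facet sigma -> sigma x -> sigma y -> x != y ->
  0 < t -> t < 1 -> relint sigma (x + t *: (y - x)).
Proof.
move=> [ps hs] sx sy xy t0 t1; set w := y - x; set z := x + t *: w.
split; first by apply: polyhedron_segment => //; exact: ltW.
have ww : 0 < dot w w.
  rewrite lt_neqAle eq_sym dot_self_eq0 subr_eq0 eq_sym xy /=.
  by apply: sumr_ge0 => i _; rewrite -expr2 sqr_ge0.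
have zE : dot w z = dot w x + t * dot w w by rewrite dotDr dotZr.
have : nbhs z (dot w @^-1` `]dot w x, dot w y[).
  apply: open_nbhs_nbhs; split.
    by apply: open_comp; [move=> ? _; exact: dot_continuous | exact: interval_open].
  rewrite /= in_itv/= zE; have -> : dot w y = dot w x + dot w w.
    by rewrite {3}/w dotBr addrC subrK.
  by rewrite ltrDl mulr_gt0// ltrD2l gtr_pMl.
apply: filterS => u /=; rewrite in_itv/= => /andP[u1 u2] su.
pose r := dot w (u - x) / dot w w.
have -> : u = x + r *: w.
  have := hyperplane_through hs (sub_affspan sx) (sub_affspan sy) xy.
  move=> /seteqP[/(_ u su) /= + _].
  have w0 : w 0 0 = y 0 0 - x 0 0 by rewrite !mxE.
  have w1 : w 0 1 = y 0 1 - x 0 1 by rewrite !mxE.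
  have rE : r * (w 0 0 * w 0 0 + w 0 1 * w 0 1) =
      w 0 0 * (u 0 0 - x 0 0) + w 0 1 * (u 0 1 - x 0 1).
    by rewrite -dot2 divfK ?gt_eqF// dot2 !mxE.
  have ww' : w 0 0 * w 0 0 + w 0 1 * w 0 1 != 0 by rewrite -dot2 gt_eqF.
  rewrite -w0 -w1 => e.
  have h0 : u 0 0 - x 0 0 = r * w 0 0.
    apply: (mulIf ww'); have := congr1 ( *%R (w 0 1)) e.
    have := congr1 ( *%R (w 0 0)) rE; lra.
  have h1 : u 0 1 - x 0 1 = r * w 0 1.
    apply: (mulIf ww'); have := congr1 ( *%R (w 0 0)) e.
    have := congr1 ( *%R (w 0 1)) rE; lra.
  by apply: row2P; rewrite mxE [X in _ = _ + X]mxE; lra.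
apply: polyhedron_segment => //.
  by rewrite divr_ge0 ?(ltW ww)// dotBr subr_ge0 ltW.
rewrite ler_pdivrMr// mul1r dotBr [X in _ <= X]dotBr lerD2r; exact: ltW.
Qed.

Lemma relint_infinite sigma : facet sigma -> infinite_set (relint sigma).
Proof.
move=> fs; have [ps hs] := fs.
have [x [y [sx sy xy]]] : exists x y, [/\ sigma x, sigma y & x != y].
  apply: contrapT => H; have [u [v [su sv /eqP]]] := hyperplane_two_points hs.
  apply; apply: (affspan_subsingleton _ su sv) => u' v' su' sv'.
  by apply/eqP; apply: contrapT => /negP h; apply: H; exists u', v'.
(* The shift by 2 keeps the parameter strictly between 0 and 1. *)
pose f (k : nat) := x + k.+2%:R^-1 *: (y - x).
have fI : injective f.
  move=> k l /addrI /eqP; rewrite -subr_eq0 -scalerBl scaler_eq0.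
  rewrite [y - x == 0]subr_eq0 [y == x]eq_sym (negPf xy) orbF subr_eq0.
  by rewrite (inj_eq invr_inj) eqr_nat => /eqP[].
apply: (@sub_infinite_set _ (range f)).
  move=> _ [k _ <-]; apply: segment_relint => //.
  by rewrite invf_lt1 ?ltr0n// ltr1n.
have /card_eqPle[_ h] := inj_card_eq (in2W fI : {in [set: nat] &, injective f}).
by apply/infiniteP.
Qed.

(** [u - v] is orthogonal to every direction of the half-plane, and it or its opposite is such a
    direction. *)
Lemma slope_eq phi x b c u v e : dot b x = c ->
  (\forall y \near x, c <= dot b y -> phi y = phi x + dot u (y - x)) ->
  (\forall y \near x, phi y = dot v y + e) -> u = v.
Proof.
move=> bx hu hv.
have hx : phi x = dot v x + e by exact: (nbhs_singleton hv).
have key w : 0 <= dot b w -> dot (u - v) w = 0.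
  move=> bw; have [r r0 rP] := near_ray w (filterI hu hv).
  have [|h1 h2] := rP (r / 2); first by rewrite gtr0_norm ?divr_gt0//; lra.
  have r2 : 0 < r / 2 by rewrite divr_gt0.
  have := h1 _; rewrite h2 hx addrAC [_ + _ - x]addrC.
  rewrite addKr !dotDr !dotZr bx lerDl mulr_ge0 ?(ltW r2)// => /(_ isT) h.
  apply: (mulfI (lt0r_neq0 r2)); rewrite dotBl mulr0; lra.
apply/eqP; rewrite -subr_eq0 -dot_self_eq0; apply/eqP.
have [h|/ltW h] := leP 0 (dot b (u - v)); first exact: key.
have := key (- (u - v)); rewrite -scaleN1r !dotZr => /(_ _)/wrap[|]; lra.
Qed.

(** Nonzero weight rules out the concave case, which is truncated to 0, and affineness near a
    relative interior point, which would equate the two gradients. *)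
Lemma face_Vplus phi sigma w : face (Vplus phi) sigma w ->
  facet sigma /\ relint sigma `<=` supp (Vplus phi).
Proof.
move=> [[w' [/= fs [u1 [u2 [[b [c [b0 sE sep]]] h]]]] ->] w0].
split => // x xs; apply: subset_closure.
have [cvx w'E] : (forall x, relint sigma x -> convex_near phi x) /\ w' = enorm (u1 - u2).
  case: h => // -[_ w'E]; exfalso; move/eqP: w0; apply; apply/max_idPr.
  by rewrite w'E oppr_le0 sqrtr_ge0.
split; first exact: cvx.
move=> [v [e hv]]; move/eqP: w0; apply.
have bx : dot b x = c.
  by have : affspan sigma x by [apply: sub_affspan; case: xs]; rewrite sE.
have u1v : u1 = v.
  by apply: (@slope_eq phi x b c u1 v e) => //; apply: filterS (sep _ xs) => y [].
have u2v : u2 = v.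
  apply: (@slope_eq phi x (- b) (- c) u2 v e); rewrite ?dotNl ?bx//.
  by apply: filterS (sep _ xs) => y [_ h2]; rewrite dotNl lerN2.
by rewrite w'E u1v u2v subrr /enorm dot0l sqrtr0 maxxx.
Qed.
End Faces.

Theorem proposition4 (R : realType) (phi : 'rV[R]_2 -> R)
    (hphi : piecewise_linear phi)
    (n : nat) (V : 'I_n -> wcomplex R 2)
    (hV : minimal_fbalancing V (Vplus phi)) :
  exists (N : nat) (A : 'I_N -> wcomplex R 2),
    lists_arrangement A (Vplus phi) /\ fComp A <= 3 * fComp V.
Proof.
set X := Vplus phi.
have [[n0 tV [_ XV _]] _] := hV.
have m0 i : (0 < mComp (V i))%N := (curve_lines (tV i)).1.
have /choice[s sP] i := (curve_lines (tV i)).2.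
pose Ls := flatten [seq s i | i <- enum 'I_n].
have sizeLs : (size Ls <= \sum_i 3 * (mComp (V i)).-1)%N.
  rewrite size_flatten /shape -map_comp sumnE big_map big_enum /=.
  by apply: leq_sum => i _; exact: (sP i).1.
have arr_supp A : arrangement X A -> hyperplane (supp A) /\ supp A \in Ls.
  move=> [sigma [w [fw _ ->]]] /=.
  have [fs rs] := face_Vplus fw; have [_ hs] := fs; split=> //.
  have [i iL] : exists i, infinite_set (affspan sigma `&` supp (V i)).
    apply: contrapT => /forallNP H; apply: (relint_infinite fs).
    apply: (@sub_finite_set _ _ (\bigcup_i (affspan sigma `&` supp (V i)))).
      move=> x xs; have [i _ Vx] := XV _ (rs _ xs).
      by exists i => //; split=> //; apply: sub_affspan; case: xs.
    apply: bigcup_finite => [|i _]; first exact: finite_finset.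
    by apply: contrapT; exact: H.
  apply/flattenP; exists (s i); first by apply/mapP; exists i; rewrite ?mem_enum.
  exact: (sP i).2.
(* The largest weight depends only on the hyperplane, so the arrangement can be counted by
   supports. *)
have arr_inj A B : arrangement X A -> arrangement X B -> supp A = supp B -> A = B.
  move=> [sigma [w [fw wmax ->]]] [tau [v [fv vmax ->]]] /= e.
  by rewrite e; congr whyperplane; apply/eqP; rewrite eq_le (vmax _ _ fw e) (wmax _ _ fv (esym e)).
have /choice[h hP] : forall L, exists A, (exists2 B, arrangement X B & supp B = L) ->
    arrangement X A /\ supp A = L.
  move=> L; have [[B ? ?]|nB] := pselect (exists2 B, arrangement X B & supp B = L).
    by exists B.
  by exists X.
(* [Ls] may contain lines that no face of [X] spans; these are dropped. *)
pose T := [seq L <- undup Ls | `[< exists2 B, arrangement X B & supp B = L >]].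
have uT : uniq T by rewrite filter_uniq// undup_uniq.
have TP (i : 'I_(size T)) : arrangement X (h (tnth (in_tuple T) i)) /\
    supp (h (tnth (in_tuple T) i)) = tnth (in_tuple T) i.
  apply: hP; have : tnth (in_tuple T) i \in T by exact: mem_tnth.
  by rewrite mem_filter => /andP[/asboolP].
exists (size T), (fun i => h (tnth (in_tuple T) i)); split.
  split=> [i j /(congr1 (@supp _ _))|].
    rewrite (TP i).2 (TP j).2 => e; apply/val_inj/eqP.
    by move/eqP: e; rewrite !(tnth_nth set0) nth_uniq.
  apply/seteqP; split=> [_ [i _ <-]|A XA]; first exact: (TP i).1.
  have : supp A \in T.
    rewrite mem_filter mem_undup (arr_supp _ XA).2 andbT.
    by apply/asboolP; exists A.
  move=> /(tnthP (in_tuple T))[i Ai]; exists i => //.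
  by apply: arr_inj => //; [exact: (TP i).1 | rewrite (TP i).2].
have sT : (size T <= 3 * \sum_i (mComp (V i)).-1)%N.
  rewrite big_distrr /=; apply: leq_trans sizeLs.
  by rewrite size_filter (leq_trans (count_size _ _))// size_undup.
rewrite /fComp.
have -> : \sum_(i < size T) (mComp (h (tnth (in_tuple T) i)))%:Z = (2 * size T)%:Z.
  under eq_bigr => i _ do rewrite (mComp_hyperplane (arr_supp _ (TP i).1).1).
  rewrite sumr_const card_ord; lia.
have -> : \sum_(i < n) (mComp (V i))%:Z = (\sum_i (mComp (V i)).-1)%N%:Z + n%:Z.
  rewrite -(big_morph Posz PoszD (erefl 0%:Z)) -PoszD; congr Posz.
  rewrite -[X in (_ + X)%N](card_ord n) -sum1_card -big_split /=.
  by apply: eq_bigr => i _; rewrite addn1 prednK.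
(* With S the sum of the predecessors, the left side is [size T + 1], at most 3 S + 1, and the right
   side is 3 (S + 1). *)
lia.
Qed.
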